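(* Let $H$ be a separable complex Hilbert space. If $\mu\in M(\mathbb T,\mathcal B(H))$ and $\mathbf A=(T_{kj})_{k,j\in\mathbb N}$ is the Toeplitz matrix with $T_{kj}=\hat\mu(j-k)$ for $k,j\in\mathbb N$, then $\mathbf A\in\mathcal M_l(\ell^2(H))\cap\mathcal M_r(\ell^2(H))$ and $$\max\{\|\mathbf A\|_{\mathcal M_l(\ell^2(H))},\ \|\mathbf A\|_{\mathcal M_r(\ell^2(H))}\}\le|\mu|.$$
   Context: $\mathbb N=\{1,2,\dots\}$, $\mathbb T=\{z\in\mathbb C:|z|=1\}$ is identified with $[0,2\pi)$ via $t\mapsto e^{it}$, $\varphi_k(t)=e^{ikt}$, and $\mathfrak B(\mathbb T)$ is the Borel $\sigma$-algebra. Matrices: $\mathcal B(H)$ is the space of bounded operators on $H$. $\ell^2(H)$ is the Hilbert space of square-summable sequences $\mathbf x=(x_j)_{j\in\mathbb N}$ in $H$, $c_{00}(H)$ its subspace of finitely supported sequences. For a matrix $\mathbf A=(T_{kj})$ with entries in $\mathcal B(H)$ and $\mathbf x\in c_{00}(H)$, $\mathbf A(\mathbf x)=\big(\sum_jT_{kj}(x_j)\big)_k$; $\mathbf A\in\mathcal B(\ell^2(H))$ means that there is $C\ge0$ with $\|\mathbf A(\mathbf x)\|_{\ell^2(H)}\le C\|\mathbf x\|_{\ell^2(H)}$ for all $\mathbf x\in c_{00}(H)$, and $\|\mathbf A\|_{\mathcal B(\ell^2(H))}$ is the least such $C$. The Schur product of $\mathbf A=(T_{kj})$ and $\mathbf B=(S_{kj})$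 is $\mathbf A*\mathbf B=(T_{kj}S_{kj})$ (entrywise composition). $\mathbf A\in\mathcal M_r(\ell^2(H))$ (right Schur multiplier) if $\mathbf B*\mathbf A\in\mathcal B(\ell^2(H))$ for every $\mathbf B\in\mathcal B(\ell^2(H))$, and $\|\mathbf A\|_{\mathcal M_r(\ell^2(H))}=\inf\{C\ge0:\|\mathbf B*\mathbf A\|_{\mathcal B(\ell^2(H))}\le C\|\mathbf B\|_{\mathcal B(\ell^2(H))}\ \forall\,\mathbf B\in\mathcal B(\ell^2(H))\}$. $\mathbf A\in\mathcal M_l(\ell^2(H))$ (left Schur multiplier) and $\|\mathbf A\|_{\mathcal M_l(\ell^2(H))}$ are defined in the same way with $\mathbf A*\mathbf B$ in place of $\mathbf B*\mathbf A$. A matrix $(T_{kj})$ is Toeplitz if $T_{kj}$ depends only on $k-j$. Measures: for a Banach space $E$, $M(\mathbb T,E)$ is the space of regular ($E$-valued, countably additive) Borel vector measures $\mu$ on $\mathbb T$ of bounded variation, with norm $|\mu|=\sup\{\sum_{A\in\pi}\|\mu(A)\|:\pi\text{ a finite Borel partition of }\mathbb T\}$; regular means: for every $\varepsilon>0$ and $B\in\mathfrak B(\mathbb T)$ there are a compact $K$ and an open $O$ with $K\subset B\subset O$ and $\|\mu\|(O\setminus K)<\varepsilon$, where $\|\mu\|(B)=\sup_{\|e^*\|=1}|e^*\circ\mu|(B)$ is the semivariation. For $k\in\mathbb Z$, $\hat\mu(k)=\int\varphi_k\,d\mu\in E$. *)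

(* Defs.v *)
From HB Require Import structures.
From mathcomp Require Import all_boot all_order all_algebra.
From mathcomp Require Import sesquilinear.
From mathcomp.real_closed Require Export complex.
From mathcomp Require Import all_classical all_reals all_analysis.

Set Implicit Arguments.
Unset Strict Implicit.
Unset Printing Implicit Defensive.

Import Order.TTheory GRing.Theory Num.Def Num.Theory.
Import numFieldTopology.Exports.

Local Open Scope classical_set_scope.
Local Open Scope complex_scope.
Local Open Scope ring_scope.

(* The norm of a normed module over R[i] takes its values in R[i]; rnorm is
   the same norm with values in R (see rnormE). *)
Definition rnorm (R : realType) (V : normedModType R[i]) (x : V) : R :=
  complex.Re `|x|.

Section RNorm.
Variables (R : realType) (V : normedModType R[i]).
Implicit Types x y : V.

Lemma rnormE x : (rnorm x)%:C = `|x|.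
Proof. by rewrite /rnorm RRe_real ?normr_real. Qed.

Lemma rnorm_ge0 x : 0 <= rnorm x.
Proof. by rewrite -lecR rnormE; exact: normr_ge0. Qed.

Lemma rnorm0 : rnorm (0 : V) = 0.
Proof. by rewrite /rnorm normr0. Qed.

Lemma rnormD x y : rnorm (x + y) <= rnorm x + rnorm y.
Proof. by rewrite -lecR rmorphD/= !rnormE ler_normD. Qed.

Lemma rnormZ (a : R[i]) x : rnorm (a *: x) = rnorm (a : R[i]^o) * rnorm x.
Proof.
by apply: complexI; rewrite rmorphM/= !rnormE normrZ; congr (_ * _).
Qed.

Lemma rnorm0_eq0 x : rnorm x = 0 -> x = 0.
Proof. by move=> x0; apply/normr0_eq0; rewrite -rnormE x0. Qed.

End RNorm.

Section BoundedOperators.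
Variables (R : realType) (V W : normedModType R[i]).

Definition bounded_operator : {pred V -> W} := fun f =>
  `[< linear f /\ exists M : R, forall x, rnorm (f x) <= M * rnorm x >].

Record bop := BOp { bop_fun :> V -> W ; _ : bop_fun \in bounded_operator }.

HB.instance Definition _ := [isSub for bop_fun].
HB.instance Definition _ := [Choice of bop by <:].

Fact bounded_operator_submod_closed : submod_closed bounded_operator.
Proof.
split=> [|a f g /asboolP[lf [M fM]] /asboolP[lg [N gN]]]; apply/asboolP; split.
- by move=> a x y; rewrite scaler0 addr0.
- by exists 0 => x; rewrite rnorm0 mul0r.
- move=> b x y.
  rewrite -[LHS]/(a *: f (b *: x + y) + g (b *: x + y)).
  rewrite -[RHS]/(b *: (a *: f x + g x) + (a *: f y + g y)).
  rewrite lf lg !scalerDr !scalerA (mulrC b a) -!addrA; congr +%R.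
  by rewrite addrCA.
- exists (rnorm (a : R[i]^o) * M + N) => x.
  rewrite -[in leLHS]/(a *: f x + g x) mulrDl -mulrA.
  by rewrite (le_trans (rnormD _ _))// rnormZ lerD// ler_wpM2l// rnorm_ge0.
Qed.

HB.instance Definition _ :=
  GRing.isSubmodClosed.Build _ _ bounded_operator
    bounded_operator_submod_closed.
HB.instance Definition _ := [SubChoice_isSubLmodule of bop by <:].

Definition opnorm (f : V -> W) : R :=
  inf [set M : R | 0 <= M /\ forall x, rnorm (f x) <= M * rnorm x].


Implicit Types f g : bop.

Lemma bop_linear f : linear f.
Proof. by have /asboolP[] := valP f. Qed.

Lemma bop_ext f g : f =1 g -> f = g.
Proof. by move=> fg; apply/val_inj/funext. Qed.

Lemma bop0 f : f 0 = 0.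
Proof.
by have := bop_linear f (-1) 0 0; rewrite scaler0 addr0 scaleN1r addNr.
Qed.

Lemma bopZ f a x : f (a *: x) = a *: f x.
Proof. by have := bop_linear f a x 0; rewrite bop0 !addr0. Qed.

Lemma bopD f x y : f (x + y) = f x + f y.
Proof. by have := bop_linear f 1 x y; rewrite !scale1r. Qed.

Lemma bop_bounded f :
  exists M : R, 0 <= M /\ forall x, rnorm (f x) <= M * rnorm x.
Proof.
have /asboolP[_ [M fM]] := valP f; exists `|M|; split=> // x.
by rewrite (le_trans (fM x))// ler_wpM2r ?rnorm_ge0// ler_norm.
Qed.

Let bounds f := [set M : R | 0 <= M /\ forall x, rnorm (f x) <= M * rnorm x].

Let lbound_bounds f : lbound (bounds f) 0.
Proof. by move=> M []. Qed.

Lemma opnorm_ge0 f : 0 <= opnorm f.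
Proof. by apply: lb_le_inf; [exact: bop_bounded|exact: lbound_bounds]. Qed.

Lemma opnorm_le f M : 0 <= M -> (forall x, rnorm (f x) <= M * rnorm x) ->
  opnorm f <= M.
Proof. by move=> M0 fM; apply: ge_inf; [exists 0; exact: lbound_bounds|]. Qed.

Lemma opnormP f x : rnorm (f x) <= opnorm f * rnorm x.
Proof.
have [->|x0] := eqVneq x 0; first by rewrite bop0 !rnorm0 mulr0.
have {x0}x_gt0 : 0 < rnorm x.
  rewrite lt_neqAle rnorm_ge0 eq_sym andbT.
  by apply: contra_neq x0 => /rnorm0_eq0.
rewrite -ler_pdivrMr//; apply: lb_le_inf; first exact: bop_bounded.
by move=> M [_ fM]; rewrite ler_pdivrMr.
Qed.

Fact opnormD f g : (opnorm (f + g))%:C <= (opnorm f)%:C + (opnorm g)%:C.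
Proof.
rewrite -rmorphD lecR; apply: opnorm_le => [|x].
  by rewrite addr_ge0 ?opnorm_ge0.
rewrite -[in leLHS]/(f x + g x) (le_trans (rnormD _ _))// mulrDl.
by rewrite lerD ?opnormP.
Qed.

Fact opnormZ (a : R[i]) f : (opnorm (a *: f))%:C = `|a| * (opnorm f)%:C.
Proof.
rewrite -[`|a|]/(`|a : R[i]^o|) -rnormE -rmorphM; congr real_complex_def.
apply/le_anti/andP; split.
  apply: opnorm_le => [|x]; first by rewrite mulr_ge0 ?rnorm_ge0 ?opnorm_ge0.
  rewrite -[in leLHS]/(a *: f x) rnormZ -mulrA.
  by rewrite ler_wpM2l ?rnorm_ge0 ?opnormP.
have [->|a0] := eqVneq a 0; first by rewrite rnorm0 mul0r opnorm_ge0.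
have a_gt0 : 0 < rnorm (a : R[i]^o).
  rewrite lt_neqAle rnorm_ge0 eq_sym andbT.
  by apply: contra_neq a0 => /(@rnorm0_eq0 _ R[i]^o).
rewrite mulrC -ler_pdivlMr//; apply: opnorm_le => [|x].
  by rewrite divr_ge0 ?opnorm_ge0 ?rnorm_ge0.
rewrite mulrAC ler_pdivlMr// mulrC -rnormZ.
exact: (opnormP (a *: f)).
Qed.

Fact opnorm0_eq0 f : (opnorm f)%:C = 0 -> f = 0.
Proof.
move=> /complexI f0; apply: bop_ext => x; apply: rnorm0_eq0.
by apply/le_anti; rewrite rnorm_ge0 (le_trans (opnormP f x))// f0 mul0r lexx.
Qed.

HB.instance Definition _ :=
  Lmodule_isNormed.Build R[i] bop opnormD opnormZ opnorm0_eq0.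

Lemma rnorm_bop f : rnorm f = opnorm f.
Proof. by []. Qed.

End BoundedOperators.

Section Completeness.
Variables (R : realType) (V : normedModType R[i])
  (W : completeNormedModType R[i]).

Let rball (U : normedModType R[i]) (x y : U) (e : R) :
  ball x e%:C y <-> rnorm (x - y) < e.
Proof. by rewrite -ball_normE /ball_/= -rnormE ltcR. Qed.

Lemma bop_complete (F : set_system (bop V W)) :
  ProperFilter F -> cauchy F -> cvg F.
Proof.
move=> FF /cauchyP Fc.
have {}Fc (e : R) : 0 < e -> exists f0, \forall f \near F, rnorm (f0 - f) < e.
  move=> e0; have [|f0 Ff0] := Fc e%:C; first by rewrite ltcR.
  by exists f0; apply: filterS Ff0 => f /rball.
have dist (f g : bop V W) x : rnorm (f x - g x) <= rnorm (f - g) * rnorm x.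
  exact: opnormP (f - g) x.
pose L x : W := lim ((fun f : bop V W => f x) @ F).
have Lcvg x : (fun f : bop V W => f x) @ F --> L x.
  apply: cauchy_cvg; apply/cauchyP => e e0.
  have er : e = (complex.Re e)%:C by rewrite RRe_real// gtr0_real.
  have {}e0 : 0 < complex.Re e by rewrite -ltcR -er.
  have x1 : 0 < rnorm x + 1 by rewrite ltr_wpDl ?rnorm_ge0.
  have [|f0 Ff0] := Fc (complex.Re e / (rnorm x + 1)); first exact: divr_gt0.
  exists (f0 x); apply: filterS Ff0 => f ff0; rewrite /= er; apply/rball.
  rewrite (le_lt_trans (dist _ _ _))//.
  rewrite (@le_lt_trans _ _ (rnorm (f0 - f) * (rnorm x + 1)))//.
    by rewrite ler_wpM2l ?rnorm_ge0// lerDl.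
  by rewrite -ltr_pdivlMr.
have Llin : linear L.
  move=> a x y; apply: (@cvg_unique _ (@norm_hausdorff _ _) _ _ _ _ (Lcvg _)).
  rewrite (_ : (fun f : bop V W => _) = (fun f => a *: f x + f y)); last first.
    by apply/funext => f; rewrite bop_linear.
  by apply: cvgD; [apply: cvgZr|]; exact: Lcvg.
have Ldist f0 (e : R) x : (\forall f \near F, rnorm (f0 - f) < e) ->
    rnorm (f0 x - L x) <= e * rnorm x.
  move=> Ff0; apply/ler_addgt0Pr => d d0.
  have /cvgrPdist_lt/(_ d%:C) := Lcvg x.
  rewrite ltcR => /(_ d0) Fd; near F => f.
  rewrite -(subrK (f x) (f0 x)) -addrA (le_trans (rnormD _ _))// lerD//.
    rewrite (le_trans (dist _ _ _))// ler_wpM2r ?rnorm_ge0// ltW//.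
    by near: f.
  rewrite -lecR rnormE distrC ltW//; near: f; exact: Fd.
have LP : L \in @bounded_operator R V W.
  apply/asboolP; split=> //; have [//|f0 Ff0] := Fc 1.
  exists (1 + rnorm f0) => x; rewrite -(subrK (f0 x) (L x)) mulrDl.
  rewrite (le_trans (rnormD _ _))// lerD//; last exact: opnormP.
  by rewrite -[leLHS]/(complex.Re `|_|) distrC; exact: Ldist Ff0.
apply/cvg_ex; exists (BOp LP); apply/cvgrPdist_lt => e e0.
have er : e = (complex.Re e)%:C by rewrite RRe_real// gtr0_real.
have {}e0 : 0 < complex.Re e by rewrite -ltcR -er.
have [|f0 Ff0] := Fc (complex.Re e / 2); first by rewrite divr_gt0.
apply: filterS (Ff0) => f ff0; rewrite er -rnormE ltcR.
rewrite -(subrK f0 (BOp LP)) -addrA (le_lt_trans (rnormD _ _))//.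
rewrite [ltRHS]splitr ler_ltD//.
apply: opnorm_le => [|x]; first by rewrite divr_ge0 ?ltW.
rewrite -[leLHS]/(complex.Re `|L x - f0 x|) distrC; exact: Ldist.
Unshelve. all: by end_near. Qed.

HB.instance Definition _ := Uniform_isComplete.Build (bop V W) bop_complete.

End Completeness.

Section Composition.
Variables (R : realType) (U V W : normedModType R[i]).

Fact bop_comp_subproof (f : bop V W) (g : bop U V) :
  f \o g \in @bounded_operator R U W.
Proof.
apply/asboolP; split=> [a x y|] /=; first by rewrite !bop_linear.
exists (opnorm f * opnorm g) => x; rewrite (le_trans (opnormP f _))// -mulrA.
by rewrite ler_wpM2l ?opnorm_ge0 ?opnormP.
Qed.

Definition bop_comp (f : bop V W) (g : bop U V) : bop U W :=
  BOp (bop_comp_subproof f g).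

End Composition.

Section VectorMeasures.
Variables (R : realType) (X : topologicalType).

Definition borel_set : set (set X) := <<s @open X >>.

Section Variation.
Variable E : normedModType R[i].
Implicit Types mu : set X -> E.

(* Set functions are total; only their values on Borel sets are relevant.
   Taking all the F i empty gives mu set0 = 0. *)
Definition countably_additive mu : Prop :=
  forall F : nat -> set X, (forall i, borel_set (F i)) -> trivIset setT F ->
    (fun n => \sum_(0 <= i < n) mu (F i)) @ \oo --> mu (\bigcup_i F i).

Definition mvariation mu (B : set X) : \bar R :=
  ereal_sup [set v | exists (n : nat) (F : nat -> set X),
    [/\ partition `I_n F B, (forall i, (i < n)%N -> borel_set (F i)) &
        v = (\sum_(0 <= i < n) rnorm (mu (F i)))%:E]].

Definition total_mvariation mu : \bar R := mvariation mu setT.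

End Variation.

Section BanachValued.
Variable E : completeNormedModType R[i].
Implicit Types (mu : set X -> E) (f s : X -> R[i]^o).

Definition msemivariation mu (B : set X) : \bar R :=
  ereal_sup [set mvariation (fun A => e (mu A)) B
            | e in [set e : bop E R[i]^o | rnorm e = 1]].

Definition regular_vmeasure mu : Prop :=
  forall (eps : R) (B : set X), 0 < eps -> borel_set B ->
    exists K O : set X, [/\ compact K, open O, K `<=` B, B `<=` O &
                            (msemivariation mu (O `\` K) < eps%:E)%E].

(* The space M(X, E), normed by total_mvariation. *)
Definition bv_measure mu : Prop :=
  [/\ countably_additive mu, regular_vmeasure mu &
      (total_mvariation mu < +oo)%E].

Definition borel_simple s : Prop :=
  finite_set (range s) /\ forall c, borel_set (s @^-1` [set c]).

Definition simple_integral mu s : E :=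
  \sum_(c \in range s) c *: mu (s @^-1` [set c]).

(* The filter generated by the uniform neighbourhoods of f in the space of
   simple functions. *)
Definition simple_approx f : set_system (X -> R[i]^o) :=
  filter_from [set eps : R | 0 < eps]
    (fun eps => [set s | borel_simple s /\ forall t, rnorm (f t - s t) < eps]).

(* The integral of a bounded Borel function: the continuous extension, for
   uniform convergence, of the integral of simple functions. *)
Definition vintegral mu f : E := lim (simple_integral mu @ simple_approx f).

End BanachValued.

End VectorMeasures.

Section Fourier.
Variable R : realType.

(* The unit circle, with the topology induced by that of the plane. *)
Definition unit_circle : set R[i]^o := [set z | `|z| = 1].
Definition circle : Type := set_type unit_circle.

HB.instance Definition _ := Topological.copy circle (set_type unit_circle).

(* At z = e^(it), z ^ k = e^(ikt). *)
Definition circle_char (k : int) (z : circle) : R[i]^o :=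
  (set_val z : R[i]) ^ k.

Definition fourier_coef (E : completeNormedModType R[i]) (mu : set circle -> E)
    (k : int) : E :=
  vintegral mu (circle_char k).

End Fourier.

Section OperatorMatrices.
Variables (R : realType) (H : completeNormedModType R[i]).

(* Rows and columns are indexed from 0 rather than from 1; differences of
   indices are unaffected. *)
Definition op_matrix := nat -> nat -> bop H H.

Implicit Types (A B : op_matrix) (x : nat -> H).

(* Equal to +oo when x is not square-summable. *)
Definition l2norm x : \bar R :=
  sqrte (\sum_(0 <= j <oo) (rnorm (x j) ^+ 2)%:E)%E.

Definition c00 : set (nat -> H) := [set x | finite_set [set j | x j != 0]].

Definition opmx_apply A x : nat -> H :=
  fun k => \sum_(j \in [set: nat]) A k j (x j).

Definition opmx_bound A : set R :=
  [set C | 0 <= C /\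
    forall x, c00 x -> (l2norm (opmx_apply A x) <= C%:E * l2norm x)%E].

Definition opmx_bounded A : Prop := opmx_bound A !=set0.

Definition opmx_norm A : \bar R := ereal_inf (EFin @` opmx_bound A).

Definition schur A B : op_matrix := fun k j => bop_comp (A k j) (B k j).

Definition right_multiplier A : Prop :=
  forall B, opmx_bounded B -> opmx_bounded (schur B A).

Definition left_multiplier A : Prop :=
  forall B, opmx_bounded B -> opmx_bounded (schur A B).

Definition right_multiplier_norm A : \bar R :=
  ereal_inf (EFin @` [set C : R | 0 <= C /\ forall B, opmx_bounded B ->
    (opmx_norm (schur B A) <= C%:E * opmx_norm B)%E]).

Definition left_multiplier_norm A : \bar R :=
  ereal_inf (EFin @` [set C : R | 0 <= C /\ forall B, opmx_bounded B ->
    (opmx_norm (schur A B) <= C%:E * opmx_norm B)%E]).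

End OperatorMatrices.

(* Main.v *)
Require Import Defs.
From HB Require Import structures.
From mathcomp Require Import all_boot all_order all_algebra.
From mathcomp Require Import sesquilinear.
From mathcomp.real_closed Require Import complex.
From mathcomp Require Import finmap lra ring.
From mathcomp Require Import all_classical all_reals all_analysis.

Set Implicit Arguments.
Unset Strict Implicit.
Unset Printing Implicit Defensive.

Import Order.TTheory GRing.Theory Num.Def Num.Theory.
Import numFieldTopology.Exports.

Local Open Scope classical_set_scope.
Local Open Scope complex_scope.
Local Open Scope ring_scope.

(* Approximate z uniformly on the circle by a function with finitely many values
   h_i, taken on Borel sets E_i. Then T_kj is approximated by
   sum_i h_i^(j-k) mu(E_i), and the Schur product of this matrix with B factors
   through B itself: writing D_i for the diagonal unitary (h_i^j)_j, it equals
   sum_i D_i^* mu(E_i) B D_i (with mu(E_i) moved to the right of B for the other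
   order of the factors). Its norm is at most sum_i |mu(E_i)| |B| <= |mu| |B|,
   and this bound passes to entrywise limits of matrices. *)

(** * Euclidean norms of initial segments of vector sequences *)

Section FiniteL2.
Variables (R : realType) (V : normedModType R[i]).
Implicit Types (x y : nat -> V).

Definition l2trunc (N : nat) x : R := Num.sqrt (\sum_(k < N) rnorm (x k) ^+ 2).

Lemma l2trunc_ge0 N x : 0 <= l2trunc N x.
Proof. exact: sqrtr_ge0. Qed.

Lemma l2truncS N x :
  l2trunc N.+1 x = Num.sqrt (l2trunc N x ^+ 2 + rnorm (x N) ^+ 2).
Proof.
by rewrite /l2trunc big_ord_recr/= sqr_sqrtr// sumr_ge0// => k _;
  rewrite sqr_ge0.
Qed.

Lemma ler_hypot (a b c d : R) : 0 <= a <= c -> 0 <= b <= d ->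
  Num.sqrt (a ^+ 2 + b ^+ 2) <= Num.sqrt (c ^+ 2 + d ^+ 2).
Proof.
move=> /andP[a0 ac] /andP[b0 bd]; apply: ler_wsqrtr.
by rewrite lerD// ler_pXn2r// nnegrE (le_trans _ ac, le_trans _ bd).
Qed.

(** This is the triangle inequality for the modulus of the complex numbers [a + ib] and [c + id]. *)
Lemma hypotD (a b c d : R) : Num.sqrt ((a + c) ^+ 2 + (b + d) ^+ 2) <=
  Num.sqrt (a ^+ 2 + b ^+ 2) + Num.sqrt (c ^+ 2 + d ^+ 2).
Proof.
have := ler_normD (a +i* b)%C (c +i* d)%C.
by rewrite !normc_def -rmorphD lecR.
Qed.

(** Minkowski's inequality by induction on [N]: adding a coordinate is a planar situation with legs
    [l2trunc N] and the norm of the new entry, so [hypotD] gives each step. *)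
Lemma l2truncD N x y :
  l2trunc N (fun k => x k + y k) <= l2trunc N x + l2trunc N y.
Proof.
elim: N => [|N IH]; first by rewrite /l2trunc !big_ord0 sqrtr0 addr0.
rewrite !l2truncS (le_trans _ (hypotD _ _ _ _))// ler_hypot//.
  by rewrite l2trunc_ge0.
by rewrite rnorm_ge0 rnormD.
Qed.

Lemma l2trunc0 N : l2trunc N (fun=> 0 : V) = 0.
Proof.
by rewrite /l2trunc big1 ?sqrtr0// => k _; rewrite rnorm0 expr0n.
Qed.

Lemma l2trunc_sum N n (F : nat -> nat -> V) :
  l2trunc N (fun k => \sum_(i < n) F i k) <= \sum_(i < n) l2trunc N (F i).
Proof.
elim: n => [|n IH].
  rewrite big_ord0 (_ : (fun k => _) = (fun=> 0)) ?l2trunc0//.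
  by apply/funext => k; rewrite big_ord0.
rewrite big_ord_recr/= (_ : (fun k => _) =
  (fun k => \sum_(i < n) F i k + F n k)); last first.
  by apply/funext => k; rewrite big_ord_recr.
by rewrite (le_trans (l2truncD _ _ _))// lerD2r.
Qed.

Lemma l2trunc_scale N x y (c : R) : 0 <= c ->
  (forall k, rnorm (x k) <= c * rnorm (y k)) -> l2trunc N x <= c * l2trunc N y.
Proof.
move=> c0 xy; elim: N => [|N IH].
  by rewrite /l2trunc !big_ord0 sqrtr0 mulr0.
rewrite !l2truncS -{1}(ger0_norm c0) -sqrtr_sqr -sqrtrM ?sqr_ge0//.
rewrite mulrDr -!exprMn.
by rewrite ler_hypot// ?l2trunc_ge0// rnorm_ge0 xy.
Qed.

(** A crude bound, from [sqrt (a^2 + b^2) <= a + b] at each step; it suffices to make entrywise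
    small perturbations of a matrix negligible. *)
Lemma l2trunc_le_sum N x : l2trunc N x <= \sum_(k < N) rnorm (x k).
Proof.
elim: N => [|N IH]; first by rewrite /l2trunc !big_ord0 sqrtr0.
rewrite l2truncS big_ord_recr/= (le_trans _ (lerD IH (lexx _)))//.
rewrite -[leRHS]ger0_norm ?addr_ge0 ?l2trunc_ge0 ?rnorm_ge0// -sqrtr_sqr.
rewrite ler_wsqrtr// sqrrD -addrA [X in _ <= _ + X]addrC addrA lerDl.
by rewrite mulrn_wge0// mulr_ge0 ?l2trunc_ge0 ?rnorm_ge0.
Qed.

Lemma l2trunc_stable M N x : (forall j, (M <= j)%N -> x j = 0) ->
  l2trunc N x <= l2trunc M x.
Proof.
move=> x0; have sq_ge0 (P : pred nat) (F : nat -> R) m n :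
    0 <= \sum_(m <= i < n | P i) F i ^+ 2.
  by apply: sumr_ge0 => i _; exact: sqr_ge0.
rewrite /l2trunc -!(big_mkord xpredT (fun k => rnorm (x k) ^+ 2)).
apply: ler_wsqrtr; have [NM|/ltnW MN] := leqP N M.
  by rewrite [leRHS](big_cat_nat (n := N))//= lerDl sq_ge0.
rewrite (big_cat_nat (n := M))//= [X in _ + X]big1_seq ?addr0// => i.
by rewrite mem_index_iota => /andP[_ /andP[/x0 -> _]]; rewrite rnorm0 expr0n.
Qed.

End FiniteL2.

(** * Reduction of square-summable norms and matrix bounds to finite sums *)

Section L2Norm.
Variables (R : realType) (H : completeNormedModType R[i]).
Implicit Types (x : nat -> H) (A B : op_matrix H).

Lemma l2norm_le x (c : R) : 0 <= c -> (forall N, l2trunc N x <= c) ->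
  (l2norm x <= c%:E)%E.
Proof.
(* Writing [c] as the root of its square reduces the claim to the partial sums of the series. *)
move=> c0 xc; rewrite -[c%:E]gee0_abs ?lee_fin// -sqrte_sqr lee_sqrt;
  last first.
  exact: sqre_ge0.
apply: lime_le; first by apply: is_cvg_nneseries => n _ _;
  rewrite lee_fin sqr_ge0.
apply: nearW => N; rewrite sumEFin -EFin_expe lee_fin big_mkord.
rewrite -[leLHS]sqr_sqrtr; last by apply: sumr_ge0 => k _; rewrite sqr_ge0.
by rewrite ler_pXn2r ?nnegrE ?sqrtr_ge0// xc.
Qed.

Lemma l2trunc_le_l2norm N x : ((l2trunc N x)%:E <= l2norm x)%E.
Proof.
rewrite -[(l2trunc N x)%:E]/(sqrte (\sum_(k < N) rnorm (x k) ^+ 2)%:E) lee_sqrt.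
  rewrite -sumEFin -(big_mkord xpredT (fun k => (rnorm (x k) ^+ 2)%:E)).
  by apply: nneseries_lim_ge => n _ _; rewrite lee_fin sqr_ge0.
by apply: nneseries_ge0 => n _ _; rewrite lee_fin sqr_ge0.
Qed.

Lemma l2norm_finsupp M x : (forall j, (M <= j)%N -> x j = 0) ->
  l2norm x = (l2trunc M x)%:E.
Proof.
move=> x0; apply/le_anti; rewrite l2trunc_le_l2norm andbT.
by apply: l2norm_le => [|N]; [exact: l2trunc_ge0|exact: l2trunc_stable].
Qed.

Lemma opmx_apply_finsupp A M x : (forall j, (M <= j)%N -> x j = 0) ->
  opmx_apply A x = fun k => \sum_(j < M) A k j (x j).
Proof.
move=> x0; apply/funext => k; rewrite /opmx_apply (fsbig_ord _ M (fun j => A k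
  j (x j))).
apply/esym/fsbig_widen => // j [_ /= /negP]; rewrite -leqNgt => /x0 ->.
exact: bop0.
Qed.

Lemma c00P x : c00 x <-> exists M, forall j, (M <= j)%N -> x j = 0.
Proof.
split=> [/finite_seqP[S xS]|[M x0]].
  exists (\max_(j <- S) j).+1 => j Mj; apply/eqP; apply: contraTT Mj => xj.
  have jS : j \in S by have : [set j | x j != 0] j by []; rewrite xS.
  by rewrite -ltnNge ltnS (@leq_bigmax_seq _ S xpredT id).
apply: (sub_finite_set _ (finite_II M)) => j /=; apply: contraNT.
by rewrite -leqNgt => /x0 ->.
Qed.

(** Removes all extended reals. The input is supported below [M], but the output may have infinitely
    many nonzero coordinates, hence the separate cut-off [N]. *)
Lemma opmx_boundP A (C : R) : opmx_bound A C <-> 0 <= C /\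
  forall M x, (forall j, (M <= j)%N -> x j = 0) ->
  forall N, l2trunc N (fun k => \sum_(j < M) A k j (x j)) <= C * l2trunc M x.
Proof.
split=> -[C0 AC]; split=> //.
  move=> M x x0 N; have /AC : c00 x by apply/c00P; exists M.
  rewrite (l2norm_finsupp x0) (opmx_apply_finsupp _ x0) => le_AC.
  by rewrite -lee_fin (le_trans (l2trunc_le_l2norm _ _)).
move=> x /c00P[M x0].
rewrite (l2norm_finsupp x0) (opmx_apply_finsupp _ x0) -EFinM.
by apply: l2norm_le => [|N]; [rewrite mulr_ge0 ?l2trunc_ge0|exact: AC].
Qed.

Lemma opmx_boundW A (C C' : R) : C <= C' -> opmx_bound A C -> opmx_bound A C'.
Proof.
move=> CC' [C0 AC]; split=> [|x x00]; first exact: le_trans CC'.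
by rewrite (le_trans (AC x x00))// lee_wpmul2r ?lee_fin ?sqrte_ge0.
Qed.

End L2Norm.

(** * Sums, norms and compositions of bounded operators *)

Section BopAlgebra.
Variables (R : realType) (V W : normedModType R[i]).

Lemma bop_sum (f : bop V W) I (r : seq I) (P : pred I) (x : I -> V) :
  f (\sum_(i <- r | P i) x i) = \sum_(i <- r | P i) f (x i).
Proof. exact: (big_morph f (bopD f) (bop0 f)). Qed.

Lemma sum_bopE I (r : seq I) (P : pred I) (f : I -> bop V W) x :
  (\sum_(i <- r | P i) f i : bop V W) x = \sum_(i <- r | P i) f i x.
Proof. exact: (big_morph (fun g : bop V W => g x)). Qed.

Lemma rnorm_sum I (r : seq I) (P : pred I) (x : I -> V) :
  rnorm (\sum_(i <- r | P i) x i) <= \sum_(i <- r | P i) rnorm (x i).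
Proof.
elim/big_ind2: _ => [|x1 y1 x2 y2 xy1 xy2|//]; first by rewrite rnorm0.
by rewrite (le_trans (rnormD _ _))// lerD.
Qed.

Lemma rnormN (x : V) : rnorm (- x) = rnorm x.
Proof. by rewrite /rnorm normrN. Qed.

Lemma rnormZ1 (a : R[i]) (x : V) : `|a| = 1 -> rnorm (a *: x) = rnorm x.
Proof. by move=> a1; rewrite rnormZ /rnorm [X in complex.Re X]a1 mul1r. Qed.

Lemma rnorm_bop_le (f : bop V W) x : rnorm (f x) <= rnorm f * rnorm x.
Proof. exact: opnormP. Qed.

End BopAlgebra.

Lemma rnorm_comp_le (R : realType) (U V W : normedModType R[i])
  (f : bop V W) (g : bop U V) : rnorm (bop_comp f g) <= rnorm f * rnorm g.
Proof.
apply: opnorm_le => [|x]; first by rewrite mulr_ge0 ?rnorm_ge0.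
rewrite (le_trans (rnorm_bop_le f _))// -mulrA ler_wpM2l ?rnorm_ge0//.
exact: rnorm_bop_le.
Qed.

Lemma bop_compBl (R : realType) (U V W : normedModType R[i])
  (f g : bop V W) (h : bop U V) :
  bop_comp f h - bop_comp g h = bop_comp (f - g) h.
Proof. exact: bop_ext. Qed.

Lemma bop_compBr (R : realType) (U V W : normedModType R[i])
  (f : bop V W) (g h : bop U V) :
  bop_comp f g - bop_comp f h = bop_comp f (g - h).
Proof.
apply: bop_ext => x; rewrite -[LHS]/(f (g x) - f (h x)).
rewrite -[RHS]/(f (g x - h x)) -[in RHS]scaleN1r addrC [in RHS]addrC.
by rewrite bop_linear scaleN1r.
Qed.

(** * Norm bounds for Schur products *)

Section SchurMultipliers.
Variables (R : realType) (H : completeNormedModType R[i]).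
Implicit Types (A B D : op_matrix H) (x : nat -> H) (C K V : R).

(** A bound is tested on finitely many entries at a time, so entrywise approximation is enough. The
    weight [w] lets the error grow with the indices, as it does for the characters. *)
Lemma opmx_bound_approx D K (w : nat -> nat -> R) :
  (forall e : R, 0 < e -> exists D', opmx_bound D' K /\
     forall k j, rnorm (D' k j - D k j) <= e * w k j) ->
  opmx_bound D K.
Proof.
move=> approx; have [D0 [/opmx_boundP[K0 _] _]] := approx 1 ltr01.
apply/opmx_boundP; split=> // M x x0 N; apply/ler_addgt0Pr => d d0.
pose S := \sum_(k < N) \sum_(j < M) w k j * rnorm (x j).
(* With tolerance [d / (|S| + 1)] the perturbation costs at most [d]; the [1] excludes a zero
   denominator. *)
have S1 : 0 < `|S| + 1 by rewrite ltr_wpDl.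
have [D' [/opmx_boundP[_ D'K] D'D]] := approx _ (divr_gt0 d0 S1).
rewrite (_ : (fun k => _) = (fun k => \sum_(j < M) D' k j (x j) +
    \sum_(j < M) (D k j - D' k j) (x j))); last first.
  apply/funext => k; rewrite -big_split/=; apply: eq_bigr => j _.
  by rewrite -[X in _ + X]/(D k j (x j) - D' k j (x j)) addrC subrK.
rewrite (le_trans (l2truncD _ _ _))// lerD ?D'K//.
rewrite (le_trans (l2trunc_le_sum _ _))//.
apply: (@le_trans _ _ (d / (`|S| + 1) * S)).
  rewrite mulr_sumr; apply: ler_sum => k _; rewrite mulr_sumr.
  rewrite (le_trans (rnorm_sum _ _ _))//.
  apply: ler_sum => j _; rewrite (le_trans (rnorm_bop_le _ _))// mulrA.
  by rewrite ler_wpM2r ?rnorm_ge0// -rnormN opprB.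
rewrite mulrAC ler_pdivrMr// ler_pM2l// (le_trans (ler_norm _))//.
by rewrite lerDl.
Qed.

(** The norm of a bounded [B] is a real infimum, so it is approached by actual bounds [C], each of
    which transfers to [D]. *)
Lemma opmx_norm_le V B D : 0 <= V ->
  (forall C, opmx_bound B C -> opmx_bound D (V * C)) -> opmx_bounded B ->
  (opmx_norm D <= V%:E * opmx_norm B)%E.
Proof.
move=> V0 BD Bb; have infB : has_inf (opmx_bound B).
  by split=> //; exists 0 => C [].
have -> : opmx_norm B = (inf (opmx_bound B))%:E.
  by apply: ereal_inf_EFin; case: infB.
apply/lee_addgt0Pr => e e0; have V1 : 0 < V + 1 by rewrite ltr_wpDl.
(* An excess of [e / (V + 1)] over the infimum becomes at most [e] after multiplication by [V]. *)
have [C BC Ce] := inf_adherent (divr_gt0 e0 V1) infB.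
apply: (@le_trans _ _ (V * C)%:E).
  by apply: ereal_inf_lbound; exists (V * C) => //; exact: BD.
rewrite -EFinM -EFinD lee_fin.
rewrite (le_trans (ler_wpM2l V0 (ltW Ce)))// mulrDr lerD2l mulrCA.
by rewrite ger_pMr// ler_pdivrMr// mul1r lerDl.
Qed.

Lemma left_multiplier_le V A : 0 <= V ->
  (forall B C, opmx_bound B C -> opmx_bound (schur A B) (V * C)) ->
  left_multiplier A /\ (left_multiplier_norm A <= V%:E)%E.
Proof.
move=> V0 AV; split=> [B [C BC]|]; first by exists (V * C); exact: AV.
apply: ereal_inf_lbound; exists V => //; split=> // B; apply:
  opmx_norm_le => // C.
exact: AV.
Qed.

Lemma right_multiplier_le V A : 0 <= V ->
  (forall B C, opmx_bound B C -> opmx_bound (schur B A) (V * C)) ->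
  right_multiplier A /\ (right_multiplier_norm A <= V%:E)%E.
Proof.
move=> V0 AV; split=> [B [C BC]|]; first by exists (V * C); exact: AV.
apply: ereal_inf_lbound; exists V => //; split=> // B; apply:
  opmx_norm_le => // C.
exact: AV.
Qed.

Section TrigonometricSums.
Variables (n : nat) (h : nat -> R[i]) (h1 : forall i, `|h i| = 1).
Variable m : nat -> bop H H.

Definition trig_mx : op_matrix H := fun k j =>
  \sum_(i < n) h i ^ (j%:Z - k%:Z) *: m i.

Lemma exp_unimodular i k : `|h i ^ k| = 1.
Proof. by case: k => k; rewrite /exprz ?normfV normrX h1 expr1n ?invr1. Qed.

Lemma expB_unimodular i (k j : nat) :
  h i ^ (j%:Z - k%:Z) = h i ^ (- k%:Z) * h i ^ j%:Z.
Proof. by rewrite addrC expfzDr// -normr_eq0 h1 oner_eq0. Qed.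

Lemma trig_mxE k j y : trig_mx k j y =
  \sum_(i < n) h i ^ (- k%:Z) *: (h i ^ j%:Z *: m i y).
Proof.
rewrite /trig_mx sum_bopE.
by apply: eq_bigr => i _; rewrite scalerA -expB_unimodular.
Qed.

(** Splitting the exponent [j - k] puts [h i ^ j] on the input and [h i ^ (- k)] on the output. Both
    are isometric, so the [i]-th term costs only the norm of [m i] times [C]. *)
Lemma trig_schur_left B C : opmx_bound B C ->
  opmx_bound (schur trig_mx B) ((\sum_(i < n) rnorm (m i)) * C).
Proof.
move=> /opmx_boundP[C0 BC]; apply/opmx_boundP; split.
  by rewrite mulr_ge0// sumr_ge0// => i _; exact: rnorm_ge0.
move=> M x x0 N; pose y i j := h i ^ j%:Z *: x j.
pose F i k := h i ^ (- k%:Z) *: m i (\sum_(j < M) B k j (y i j)).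
rewrite (_ : (fun k => _) = (fun k => \sum_(i < n) F i k)); last first.
  apply/funext => k; under eq_bigr do rewrite /= trig_mxE.
  rewrite exchange_big/=; apply: eq_bigr => i _; rewrite -scaler_sumr.
  rewrite /F bop_sum; congr (_ *: _).
  by apply: eq_bigr => j _; rewrite !bopZ.
rewrite (le_trans (l2trunc_sum _ _ _))// !mulr_suml; apply: ler_sum => i _.
apply: (@le_trans _ _ (rnorm (m i) *
    l2trunc N (fun k => \sum_(j < M) B k j (y i j)))).
  apply: l2trunc_scale => [|k]; first exact: rnorm_ge0.
  by rewrite rnormZ1 ?exp_unimodular// rnorm_bop_le.
rewrite -mulrA ler_wpM2l ?rnorm_ge0// (le_trans (BC _ _ _ _))// => [j Mj|].
  by rewrite /y x0// scaler0.
rewrite ler_wpM2l// -[leRHS]mul1r; apply: l2trunc_scale => // j.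
by rewrite mul1r rnormZ1 ?exp_unimodular.
Qed.

(** The same factorization, except that [m i] acts on the input before [B]; its norm is therefore
    paid in the estimate of [y i]. *)
Lemma trig_schur_right B C : opmx_bound B C ->
  opmx_bound (schur B trig_mx) ((\sum_(i < n) rnorm (m i)) * C).
Proof.
move=> /opmx_boundP[C0 BC]; apply/opmx_boundP; split.
  by rewrite mulr_ge0// sumr_ge0// => i _; exact: rnorm_ge0.
move=> M x x0 N; pose y i j := h i ^ j%:Z *: m i (x j).
pose F i k := h i ^ (- k%:Z) *: \sum_(j < M) B k j (y i j).
rewrite (_ : (fun k => _) = (fun k => \sum_(i < n) F i k)); last first.
  apply/funext => k; transitivity
      (\sum_(j < M) \sum_(i < n) h i ^ (- k%:Z) *: B k j (y i j)).
    apply: eq_bigr => j _; rewrite /= trig_mxE.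
    rewrite bop_sum.
    by apply: eq_bigr => i _; rewrite bopZ.
  by rewrite exchange_big/=; apply: eq_bigr => i _; rewrite -scaler_sumr.
rewrite (le_trans (l2trunc_sum _ _ _))// !mulr_suml; apply: ler_sum => i _.
apply: (@le_trans _ _ (1 * l2trunc N (fun k => \sum_(j < M) B k j (y i j)))).
  by apply: l2trunc_scale => // k; rewrite mul1r rnormZ1 ?exp_unimodular.
rewrite mul1r -mulrA mulrCA (le_trans (BC _ _ _ _))// => [j Mj|].
  by rewrite /y x0// bop0 scaler0.
rewrite ler_wpM2l//; apply: l2trunc_scale => [|j]; first exact: rnorm_ge0.
by rewrite rnormZ1 ?exp_unimodular// rnorm_bop_le.
Qed.

End TrigonometricSums.
End SchurMultipliers.

(** * Borel sets and finite Borel partitions *)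

Section BorelSets.
Variable X : topologicalType.
Implicit Types A B : set X.

Lemma borel_open A : open A -> borel_set A.
Proof. exact: sub_sigma_algebra. Qed.

Lemma borel_set0 : borel_set (@set0 X).
Proof. by have [] := smallest_sigma_algebra [set: X] open. Qed.

Lemma borel_setC A : borel_set A -> borel_set (~` A).
Proof.
by move=> bA; rewrite -setTD; have [_ + _] := smallest_sigma_algebra [set:
  X] open; apply.
Qed.

Lemma borel_bigcup (F : nat -> set X) : (forall i, borel_set (F i)) ->
  borel_set (\bigcup_i F i).
Proof. by have [_ _] := smallest_sigma_algebra [set: X] open; apply. Qed.

Lemma borel_setU A B : borel_set A -> borel_set B -> borel_set (A `|` B).
Proof.
move=> bA bB; rewrite (_ : A `|` B = \bigcup_i (if i is 0 then A else B)).
  by apply: borel_bigcup => -[].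
apply/seteqP; split=> [x [Ax|Bx]|x [[_ Ax|i _ Bx]]];
  [by exists 0|by exists 1| |].
  by left.
by right.
Qed.

Lemma borel_setI A B : borel_set A -> borel_set B -> borel_set (A `&` B).
Proof.
move=> bA bB; rewrite -[A `&` B]setCK setCI.
apply: (@borel_setC (_ `|` _)); apply: (@borel_setU (~` A) (~` B)).
  exact: (@borel_setC A).
exact: (@borel_setC B).
Qed.

End BorelSets.

(* Surjectivity onto `I_n makes the cells nonempty, as [partition] demands in
   mvariation. *)
Definition borel_index (X : topologicalType) (n : nat) (p : X -> nat) : Prop :=
  range p = `I_n /\ forall i, borel_set (p @^-1` [set i]).

(** The values of [q] are listed without repetition and [p] gives the position of [q x] in that
    list, so the fibres of [p] are fibres of [q]. *)
Lemma borel_index_factor (X : topologicalType) (T : choiceType) (t0 : T)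
    (q : X -> T) : finite_set (range q) ->
    (forall t, borel_set (q @^-1` [set t])) ->
  exists n p (h : nat -> T), borel_index n p /\ q = h \o p.
Proof.
move=> /finite_seqP[s qs] bq.
have qin x : q x \in undup s.
  by have : range q (q x) by [exists x]; rewrite mem_undup qs.
exists (size (undup s)), (fun x => index (q x) (undup s)), (nth t0 (undup s)).
split; last by apply/funext => x /=; rewrite nth_index.
split=> [|i].
  apply/seteqP; split=> [_ [x _ <-]|i /= si]; first by rewrite /= index_mem.
  have : [set` s] (nth t0 (undup s) i) by rewrite /= -mem_undup mem_nth.
  by rewrite -qs => -[x _ qx]; exists x; rewrite // qx index_uniq ?undup_uniq.
have [si|si] := ltnP i (size (undup s)).
  rewrite (_ : _ @^-1` _ = q @^-1` [set nth t0 (undup s) i])//.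
  apply/seteqP; split=> x /= => [<-|->]; first by rewrite nth_index.
  by rewrite index_uniq ?undup_uniq.
(* Every value of [q] occurs in the list, so no position reaches its length. *)
rewrite (_ : _ @^-1` _ = set0); first exact: borel_set0.
by apply/seteqP; split=> // x /= xi; move: si; rewrite -xi leqNgt index_mem qin.
Qed.

(** * Finite additivity and integrals of simple functions *)

Section VectorMeasure.
Variables (R : realType) (X : topologicalType) (E : completeNormedModType R[i]).
Variables (mu : set X -> E) (mu_add : countably_additive mu).

(** The partial sums of the constant series [mu set0] converge, so their consecutive differences,
    all equal to [mu set0], tend to zero. *)
Lemma countably_additive0 : mu set0 = 0.
Proof.
have : (fun n => \sum_(0 <= i < n) mu set0) @ \oo --> mu set0.
  rewrite -[X in _ --> mu X](bigcup0 (P := setT) (F := fun _ : nat => set0))//.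
  apply: mu_add => [i|i j _ _ [x []]//]; exact: borel_set0.
move=> mu0; have mu0S := mu0; rewrite -cvg_shiftS in mu0S.
have := cvgB mu0S mu0; rewrite subrr (_ : (_ - _) = fun=> mu set0).
  by move=> /(_ _)/(cvg_unique (@norm_hausdorff _ E) (cvg_cst _)); apply.
apply/funext => n.
by rewrite -[LHS]/(\sum_(0 <= i < n.+1) _ - \sum_(0 <= i < n) _)
  big_nat_recr//= addrAC subrr add0r.
Qed.

(** The family is padded with empty sets from [n] on, which makes the partial sums eventually
    constant. *)
Lemma additive_bigcup n (F : nat -> set X) : (forall i, borel_set (F i)) ->
  trivIset setT F -> mu (\bigcup_(i in `I_n) F i) = \sum_(i < n) mu (F i).
Proof.
move=> bF tF; pose G i := if (i < n)%N then F i else set0.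
have G0 i : (n <= i)%N -> G i = set0 by rewrite /G ltnNge => ->.
have GF i x : G i x -> (i < n)%N /\ F i x by rewrite /G; case: ifP.
have -> : \bigcup_(i in `I_n) F i = \bigcup_i G i.
  apply/seteqP; split=> [x [i /= ni Fx]|x [i _ /GF[ni Fx]]]; last by exists i.
  by exists i => //; rewrite /G ni.
have bG i : borel_set (G i).
  by rewrite /G; case: ifP => // _; exact: borel_set0.
have tG : trivIset setT G.
  by move=> i j _ _ [x [/GF[_ Fi] /GF[_ Fj]]]; apply: tF => //; exists x.
rewrite -(cvg_lim (@norm_hausdorff _ E) (mu_add bG tG)).
apply: lim_near_cst; first exact: norm_hausdorff.
exists n => // m /= nm; rewrite (big_cat_nat (n := n))//= [X in _ + X]big1_seq.
  by rewrite addr0 big_mkord; apply: eq_bigr => i _; rewrite /G ltn_ord.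
move=> i; rewrite mem_index_iota => /andP[_ /andP[/G0 -> _]].
exact: countably_additive0.
Qed.

Variables (n : nat) (p : X -> nat) (pP : borel_index n p).

Lemma additive_preimage (P : pred nat) :
  mu (p @^-1` [set i | P i]) = \sum_(i < n | P i) mu (p @^-1` [set val i]).
Proof.
have [pn bp] := pP; pose F i := if P i then p @^-1` [set i] else set0.
have -> : p @^-1` [set i | P i] = \bigcup_(i in `I_n) F i.
  apply/seteqP; split=> [x /= Px|x [i _]]; rewrite /F.
    by exists (p x); [rewrite -pn; exists x|rewrite Px].
  by case: ifP => //= Pi ->.
rewrite additive_bigcup => [|i|i j _ _ [x]].
- rewrite [RHS]big_mkcond; apply: eq_bigr => i _; rewrite /F; case: ifP => // _.
  exact: countably_additive0.
- by rewrite /F; case: ifP => // _; exact: borel_set0.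
- have FP k : F k x -> p x = k by rewrite /F; case: ifP.
  by move=> [/FP <- /FP].
Qed.

(** The integral is defined by summing over values, and [g] may take one value on several cells;
    finite additivity splits each level set into its cells. *)
Lemma simple_integral_index (g : nat -> R[i]) :
  simple_integral mu (g \o p) = \sum_(i < n) g i *: mu (p @^-1` [set val i]).
Proof.
have [pn bp] := pP.
have fin : finite_set (range (g \o p)).
  rewrite (_ : range _ = g @` range p); last by rewrite image_comp.
  by rewrite pn; apply: finite_image; exact: finite_II.
rewrite /simple_integral fsbig_finite//=.
transitivity (\sum_(c <- fset_set (range (g \o p)))
    \sum_(i < n | g i == c) c *: mu (p @^-1` [set val i])).
  apply: eq_bigr => c _; rewrite -scaler_sumr; congr (_ *: _).
  rewrite -(additive_preimage (fun i => g i == c)); congr mu.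
  by apply/seteqP; split=> x /= /eqP.
rewrite (exchange_big_dep xpredT)//=; apply: eq_bigr => i _.
have gi : g i \in fset_set (range (g \o p)).
  rewrite in_fset_set// inE.
  have : range p i by rewrite pn /=.
  by move=> [x _ <-]; exists x.
rewrite big_mkcond (bigD1_seq (g i)) ?fset_uniq//= eqxx big1 ?addr0// => c.
by rewrite eq_sym => /negPf ->.
Qed.

Lemma variation_index :
  ((\sum_(i < n) rnorm (mu (p @^-1` [set val i])))%:E <= total_mvariation mu)%E.
Proof.
have [pn bp] := pP; apply: ereal_sup_ubound; exists n,
  (fun i => p @^-1` [set i]).
split=> //; last by rewrite big_mkord.
split; last 2 first.
- exact: trivIset_preimage1.
- by move=> i; rewrite -pn => -[x _ <-]; exists x.
by apply/seteqP; split=> // x _; exists (p x) => //; rewrite -pn; exists x.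
Qed.

End VectorMeasure.

(** * Continuity of the integral under uniform convergence *)

Section Integral.
Variables (R : realType) (X : topologicalType) (E : completeNormedModType R[i]).
Variables (mu : set X -> E) (mu_add : countably_additive mu).
Hypothesis mu_fin : (total_mvariation mu < +oo)%E.
Let V := fine (total_mvariation mu).
Implicit Types f s t : X -> R[i]^o.

Lemma total_mvariation_ge0 : (0 <= total_mvariation mu)%E.
Proof.
(* A constant map supplies one admissible partition, so the supremum is over a nonempty set; if [X]
   is empty the partition has no cells. *)
have [||n [p [h [pP _]]]] := @borel_index_factor X unit tt (fun=> tt).
- exact: finite_finset.
- move=> -[]; rewrite (_ : _ @^-1` _ = ~` set0).
    exact: (borel_setC (@borel_set0 X)).
  by apply/seteqP; split=> x _ //= [].
apply: le_trans (variation_index mu pP); rewrite lee_fin.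
by apply: sumr_ge0 => i _; exact: rnorm_ge0.
Qed.

Let fine_V : V%:E = total_mvariation mu.
Proof. by rewrite fineK// ge0_fin_numE// total_mvariation_ge0. Qed.

Let V0 : 0 <= V.
Proof. exact/fine_ge0/total_mvariation_ge0. Qed.

Lemma borel_simple_comp n p (g : nat -> R[i]) : @borel_index X n p ->
  borel_simple (g \o p : X -> R[i]^o).
Proof.
move=> [pn bp]; split=> [|c].
  rewrite (_ : range _ = g @` range p); last by rewrite image_comp.
  by rewrite pn; apply: finite_image; exact: finite_II.
rewrite (_ : _ @^-1` _ = \bigcup_i if g i == c then p @^-1` [set i] else set0).
  by apply: borel_bigcup => i; case: ifP => // _; exact: borel_set0.
apply/seteqP; split=> [x /= gx|x [i _]]; first by exists (p x);
  rewrite // gx eqxx.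
by case: ifP => //= /eqP <- ->.
Qed.

(** The pair [(s, t)] has finitely many values, so both functions factor through one Borel partition
    and the integrals are compared cell by cell. *)
Lemma simple_integral_dist s t (d : R) : 0 <= d -> borel_simple s ->
  borel_simple t -> (forall x, rnorm (s x - t x) <= d) ->
  rnorm (simple_integral mu s - simple_integral mu t) <= d * V.
Proof.
move=> d0 [fs bs] [ft bt] st.
have [||n [p [h [pP sth]]]] :=
    @borel_index_factor X (R[i] * R[i])%type (0, 0) (fun x => (s x, t x)).
- apply: (sub_finite_set _ (finite_setX fs ft)) => _ [x _ <-] /=.
  by split; exists x.
- move=> [c c']; rewrite (_ : _ @^-1` _ = s @^-1` [set c] `&` t @^-1` [set c']).
    exact: borel_setI.
  by apply/seteqP; split=> x /= [-> ->].
have sE : s = (fst \o h) \o p.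
  by apply/funext => x; have /(congr1 (fun q => (q x).1)) := sth.
have tE : t = (snd \o h) \o p.
  by apply/funext => x; have /(congr1 (fun q => (q x).2)) := sth.
rewrite sE tE in st *.
rewrite !(simple_integral_index mu_add pP) -sumrB (le_trans (rnorm_sum _ _
  _))//.
apply: (@le_trans _ _ (\sum_(i < n) d * rnorm (mu (p @^-1` [set val i])))).
  apply: ler_sum => i _; rewrite -scalerBl rnormZ ler_wpM2r ?rnorm_ge0//.
  (* Each cell contains a point, so the pointwise bound applies to the coefficients. *)
  have [x _ <-] : range p i by case: pP => -> _ /=.
  exact: st.
by rewrite -mulr_sumr ler_wpM2l// -lee_fin fine_V (variation_index mu pP).
Qed.

(** By [simple_integral_dist] the integrals of approximating simple functions form a Cauchy filter,
    so the [lim] defining the integral is a genuine limit and inherits the estimate. *)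
Lemma vintegral_dist f s (d : R) : 0 <= d ->
  (forall e : R, 0 < e ->
    exists s', borel_simple s' /\ forall x, rnorm (f x - s' x) < e) ->
  borel_simple s -> (forall x, rnorm (f x - s x) <= d) ->
  rnorm (vintegral mu f - simple_integral mu s) <= d * V.
Proof.
move=> d0 f_approx bs fs.
have V1 : 0 < V + 1 by rewrite ltr_wpDl.
have FF : ProperFilter (simple_approx f).
  apply: filter_from_proper => [|e e0]; last exact: f_approx.
  apply: filter_from_filter; first by exists 1; exact: ltr01.
  move=> e1 e2 e10 e20; exists (Num.min e1 e2); first by rewrite /= lt_min;
    apply/andP.
  move=> s' [bs' fs']; split; split=> // x; have := fs' x; rewrite lt_min;
    by case/andP.
have cvI : cvg (simple_integral mu @ simple_approx f).
  apply: cauchy_cvg; apply/cauchyP => e e0.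
  have er : e = (complex.Re e)%:C by rewrite RRe_real// gtr0_real.
  have {}e0 : 0 < complex.Re e by rewrite -ltcR -er.
  (* Two simple functions within [e'] of [f] are within [2 * e'] of each other. *)
  pose e' := complex.Re e / (V + 1) / 2.
  have e'0 : 0 < e' by rewrite !divr_gt0.
  have [s0 [bs0 fs0]] := f_approx _ e'0.
  exists (simple_integral mu s0), e' => // s' [bs' fs'].
  rewrite -ball_normE /ball_/= -rnormE er ltcR.
  apply: (@le_lt_trans _ _ (complex.Re e / (V + 1) * V)); last first.
    by rewrite mulrAC ltr_pdivrMr// ltr_pM2l// ltrDl.
  apply: simple_integral_dist => // [|x]; first by rewrite ltW// divr_gt0.
  have -> : s0 x - s' x = (f x - s' x) - (f x - s0 x).
    by rewrite opprB [RHS]addrC addrA subrK.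
  rewrite (le_trans (rnormD _ _))// rnormN [leRHS]splitr lerD// ltW//.
apply/ler_addgt0Pr => e e0; pose e' := e / (V + 1).
have e'0 : 0 < e' by rewrite divr_gt0.
have /cvgrPdist_lt/(_ e'%:C) := cvI; rewrite ltcR => /(_ e'0)[e1 e10 Ie1].
(* Closeness [e1] controls the integral of [s'], and closeness [e'] its distance to [s]; the total
   error [e' + e' * V] is [e]. *)
have [|s' [bs' fs']] := f_approx (Num.min e1 e'); first by rewrite lt_min e10.
have : rnorm (vintegral mu f - simple_integral mu s') < e'.
  rewrite -ltcR rnormE; apply: Ie1; split=> // x; have := fs' x.
  by rewrite lt_min => /andP[].
have := @simple_integral_dist s' s (d + e'); move=> /(_ _ bs' bs) Is's.
move=> vs'.
have -> : d * V + e = e' + (d + e') * V.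
  rewrite mulrDl addrCA; congr (_ + _).
  by rewrite -[X in X + _]mulr1 -mulrDr [1 + V]addrC /e' divfK// gt_eqF.
rewrite -[vintegral mu f](subrK (simple_integral mu s')) -addrA.
rewrite (le_trans (rnormD _ _))// lerD// ?(ltW vs')//; apply: Is's => [|x].
  by rewrite addr_ge0// ltW.
have -> : s' x - s x = (f x - s x) - (f x - s' x).
  by rewrite opprB [RHS]addrC addrA subrK.
rewrite (le_trans (rnormD _ _))// rnormN lerD// ltW//.
by have := fs' x; rewrite lt_min => /andP[].
Qed.

End Integral.

(** * Characters and fine Borel partitions of the circle *)

Section CircleNet.
Variable R : realType.
Local Notation C := R[i].

Lemma expn_unimodular_dist (a b : C) (n : nat) : `|a| = 1 -> `|b| = 1 ->
  `|a ^+ n - b ^+ n| <= n%:R * `|a - b|.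
Proof.
move=> a1 b1; elim: n => [|n IH]; first by rewrite subrr normr0 mul0r.
have -> : a ^+ n.+1 - b ^+ n.+1 = a * (a ^+ n - b ^+ n) + (a - b) * b ^+ n.
  by rewrite !exprS mulrBr mulrBl addrA subrK.
rewrite (le_trans (ler_normD _ _))// !normrM normrX a1 b1 expr1n mul1r mulr1.
by rewrite -addn1 natrD mulrDl mul1r lerD2r.
Qed.

(** Negative exponents reduce to positive ones by [1/u - 1/v = (1/u) (v - u) (1/v)], whose outer
    factors are unimodular here. *)
Lemma expz_unimodular_dist (a b : C) (k : int) : `|a| = 1 -> `|b| = 1 ->
  `|a ^ k - b ^ k| <= `|k|%N%:R * `|a - b|.
Proof.
move=> a1 b1; case: k => n; first exact: expn_unimodular_dist.
have a0 : a != 0 by rewrite -normr_eq0 a1 oner_eq0.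
have b0 : b != 0 by rewrite -normr_eq0 b1 oner_eq0.
have -> : a ^ Negz n - b ^ Negz n =
    (a ^+ n.+1)^-1 * (b ^+ n.+1 - a ^+ n.+1) * (b ^+ n.+1)^-1.
  rewrite mulrBr mulrBl mulVf ?expf_neq0// mul1r -mulrA mulfV ?expf_neq0//.
  by rewrite mulr1 /exprz addrC.
rewrite !normrM !normfV !normrX a1 b1 !expr1n invr1 mul1r mulr1 distrC.
exact: expn_unimodular_dist.
Qed.

Lemma normc_real (a : R) : `|a%:C| = `|a|%:C.
Proof. by rewrite normc_def/= expr0n addr0 sqrtr_sqr. Qed.

Lemma normci : `|'i%C : C| = 1.
Proof. by rewrite normc_def/= expr0n add0r expr1n sqrtr1. Qed.

Lemma normc_ge_Im (w : C) : `|complex.Im w|%:C <= `|w|.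
Proof. by rewrite -normrN -ReiNIm (le_trans (normc_ge_Re _))// normrM normci
  mulr1. Qed.

Lemma normc_le_ReIm (w : C) : `|w| <= (`|complex.Re w| + `|complex.Im w|)%:C.
Proof.
rewrite {1}[w]complexE (le_trans (ler_normD _ _))// normrM normci mul1r.
by rewrite !normc_real -rmorphD.
Qed.

(** The Lipschitz condition makes the sublevel set open in the plane, hence its trace open on the
    circle. *)
Lemma borel_circle_lt (g : C -> R) (r : R) :
  (forall w w', `|(g w - g w')%:C| <= `|w - w'|) ->
  borel_set [set z : circle R | g (set_val z) < r].
Proof.
move=> g_lip; apply: borel_open.
have val_cont : continuous (set_val : circle R -> C^o) by exact:
  initial_continuous.
apply: (continuousP _).1 val_cont [set w | g w < r] _.
rewrite openE => w /= gw; apply/nbhs_ballP.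
exists (r - g w)%:C; first by rewrite /= ltcR subr_gt0.
move=> w'; rewrite -ball_normE /= => ww'.
have := le_lt_trans (g_lip w w') ww'; rewrite normc_real ltcR.
by rewrite distrC => /(le_lt_trans (ler_norm _)); rewrite ltrBlDr subrK.
Qed.

Lemma borel_circle_trunc (g : C -> R) (a : nat) :
  (forall r, borel_set [set z : circle R | g (set_val z) < r]) ->
  borel_set [set z : circle R | Num.truncn (g (set_val z)) = a].
Proof.
move=> bg; have ble b : borel_set [set z : circle R | (Num.truncn (g (set_val
  z)) <= b)%N].
  rewrite (_ : mkset _ = [set z | g (set_val z) < b.+1%:R]); first exact: bg.
  by apply/seteqP; split=> z /=; rewrite truncn_le_nat.
(* A level set of the integer part is the difference of two consecutive sublevel sets; at [0] there
   is nothing to subtract. *)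
case: a => [|a].
  rewrite (_ : mkset _ = [set z : circle R | (Num.truncn (g (set_val z)) <=
    0)%N])//.
  by apply/seteqP; split=> z /=; [move=> ->|rewrite leqn0 => /eqP].
rewrite (_ : mkset _ = [set z : circle R | (Num.truncn (g (set_val z)) <=
  a.+1)%N] `&`
    ~` [set z : circle R | (Num.truncn (g (set_val z)) <= a)%N]).
  exact: borel_setI (ble _) (borel_setC (ble _)).
apply/seteqP; split=> z /=; first by move=> ->; rewrite ltnn.
by case=> za /negP; rewrite -ltnNge => az; apply/eqP; rewrite eqn_leq za.
Qed.

Lemma truncn_dist (x y : R) : 0 <= x -> 0 <= y ->
  Num.truncn x = Num.truncn y -> `|x - y| <= 1.
Proof.
move=> /truncn_itv/andP[x1 x2] /truncn_itv/andP[y1 y2] xy.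
rewrite xy -[_.+1]addn1 natrD in x1 x2; rewrite -[_.+1]addn1 natrD in y2.
by rewrite ler_norml; apply/andP; split; lra.
Qed.

(** The circle is cut by a square grid of mesh [1 / N]. Choosing [h i] among the points of the cell
    makes it unimodular, and two points of a cell are at most [2 / N <= e] apart. *)
Lemma circle_net (e : R) : 0 < e ->
  exists n p (h : nat -> C), [/\ @borel_index (circle R) n p,
    forall i, `|h i| = 1 & forall z, `|set_val z - h (p z)| <= e%:C].
Proof.
move=> e0; pose N : R := (Num.truncn (2 / e)).+1%:R.
have N0 : 0 < N by rewrite ltr0n.
have Ne : 2 / N <= e.
  by rewrite ler_pdivrMr// mulrC -ler_pdivrMr// ltW// truncnS_gt.
(* The shift by [1] makes the coordinates nonnegative on the circle, where [truncn] is the integer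
   part. *)
pose re (w : C) := (complex.Re w + 1) * N.
pose im (w : C) := (complex.Im w + 1) * N.
have ReB (w w' : C) : complex.Re (w - w') = complex.Re w - complex.Re w'.
  by case: w w' => a b [].
have ImB (w w' : C) : complex.Im (w - w') = complex.Im w - complex.Im w'.
  by case: w w' => a b [].
have scale_lt (x r : R) : ((x + 1) * N < r) = (x < r / N - 1).
  by rewrite -ltr_pdivlMr// ltrBrDr.
have b_re r : borel_set [set z : circle R | re (set_val z) < r].
  rewrite (_ : mkset _ = [set z | complex.Re (set_val z) < r / N - 1]).
    by apply: borel_circle_lt => w w'; rewrite -ReB normc_real normc_ge_Re.
  by apply/seteqP; split=> z /=; rewrite /re scale_lt.
have b_im r : borel_set [set z : circle R | im (set_val z) < r].
  rewrite (_ : mkset _ = [set z | complex.Im (set_val z) < r / N - 1]).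
    by apply: borel_circle_lt => w w'; rewrite -ImB normc_real normc_ge_Im.
  by apply/seteqP; split=> z /=; rewrite /im scale_lt.
have val1 (z : circle R) : `|set_val z : C| <= 1.
  by have -> : `|set_val z : C| = 1 by have := set_valP z.
have re_itv (z : circle R) : 0 <= re (set_val z) <= 2 * N.
  have := le_trans (normc_ge_Re _) (val1 z); rewrite lecR ler_norml => /andP[z1
    z2].
  by rewrite mulr_ge0 ?ler_pM2r//; lra.
have im_itv (z : circle R) : 0 <= im (set_val z) <= 2 * N.
  have := le_trans (normc_ge_Im _) (val1 z); rewrite lecR ler_norml => /andP[z1
    z2].
  by rewrite mulr_ge0 ?ler_pM2r//; lra.
pose q (z : circle R) := (Num.truncn (re (set_val z)),
  Num.truncn (im (set_val z))).
have [||n [p [c [pP qE]]]] := @borel_index_factor _ _ (0%N, 0%N) q.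
- pose M := (Num.truncn (2 * N)).+1.
  apply: (sub_finite_set _ (finite_setX (finite_II M) (finite_II M))).
  move=> _ [z _ <-]; split; rewrite /= ltnS le_truncn//.
    by have /andP[] := re_itv z.
  by have /andP[] := im_itv z.
- move=> [a b]; rewrite (_ : _ @^-1` _ =
    [set z | Num.truncn (re (set_val z)) = a] `&`
    [set z | Num.truncn (im (set_val z)) = b]).
    by apply: borel_setI; exact: borel_circle_trunc.
  by apply/seteqP; split=> z; rewrite /q/= => -[-> ->].
have /choice[h hP] : forall i, exists w : C, `|w| = 1 /\
    forall z, p z = i -> `|set_val z - w| <= e%:C.
  (* Indices of no cell get the default [1], since unimodularity is required for every [i]. *)
  move=> i; have [[z0 pz0]|np] := pselect (exists z, p z = i); last first.
    by exists 1; split=> [|z pz]; [exact: normr1|case: np; exists z].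
  exists (set_val z0); split=> [|z pz]; first by have := set_valP z0.
  have : q z = q z0 by rewrite qE /= pz pz0.
  move=> [/truncn_dist rez /truncn_dist imz].
  have {}rez := rez (andP (re_itv _)).1 (andP (re_itv _)).1.
  have {}imz := imz (andP (im_itv _)).1 (andP (im_itv _)).1.
  have scaleB (x y : R) : (x + 1) * N - (y + 1) * N = (x - y) * N by ring.
  rewrite /re scaleB in rez; rewrite /im scaleB in imz.
  rewrite !normrM (gtr0_norm N0) -!ler_pdivlMr// mul1r -ReB in rez.
  rewrite !normrM (gtr0_norm N0) -!ler_pdivlMr// mul1r -ImB in imz.
  rewrite (le_trans (normc_le_ReIm _))// lecR (le_trans _ Ne)//.
  by rewrite -[2]/(1 + 1) mulrDl mul1r lerD.
by exists n, p, h; split=> // [i|z]; [case: (hP i)|case: (hP (p z)) => _;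
  apply].
Qed.

End CircleNet.

(** * Approximation of the Toeplitz matrix and the multiplier bounds *)

Section ToeplitzApproximation.
Variables (R : realType) (H : completeNormedModType R[i]).
Variables (mu : set (circle R) -> bop H H) (mu_add : countably_additive mu).
Hypothesis mu_fin : (total_mvariation mu < +oo)%E.
Let V := fine (total_mvariation mu).

Lemma circle_char_dist (e : R) (p : circle R -> nat) (h : nat -> R[i]) (k :
  int) :
  (forall i, `|h i| = 1) -> (forall z, `|set_val z - h (p z)| <= e%:C) ->
  forall z, rnorm (circle_char k z - ((fun i => h i ^ k) \o p) z : R[i]^o) <=
    `|k|%N%:R * e.
Proof.
move=> h1 hp z; rewrite -lecR rnormE.
have z1 : `|set_val z : R[i]| = 1 by have := set_valP z.
apply: le_trans (expz_unimodular_dist k z1 (h1 (p z))) _.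
by rewrite rmorphM/= rmorph_nat ler_wpM2l// ler0n.
Qed.

Lemma circle_char_approx (k : int) (e : R) : 0 < e ->
  exists s : circle R -> R[i]^o, borel_simple s /\
    forall z, rnorm (circle_char k z - s z) < e.
Proof.
move=> e0; have k1 : 0 < `|k|%N%:R + 1 :> R by rewrite ltr_wpDl// ler0n.
have [n [p [h [pP h1 hp]]]] := circle_net (divr_gt0 e0 k1).
exists ((fun i => h i ^ k) \o p); split=> [|z]; first exact:
  borel_simple_comp pP.
rewrite (le_lt_trans (circle_char_dist k h1 hp z))// mulrA ltr_pdivrMr// mulrC.
by rewrite ltr_pM2l// ltrDl.
Qed.

(** One partition of mesh [e] serves all entries at once, with [m i] the measure of the [i]-th cell.
    The factor [|j - k|] is the Lipschitz constant of the character, and the sum of norms is bounded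
    by the variation. *)
Lemma fourier_coef_approx (e : R) : 0 < e -> exists n (h : nat -> R[i]) (m :
  nat -> bop H H),
  [/\ forall i, `|h i| = 1, \sum_(i < n) rnorm (m i) <= V &
      forall k j, rnorm (trig_mx n h m k j - fourier_coef mu (j%:Z - k%:Z)) <=
        e * (`|j%:Z - k%:Z|%N%:R * V)].
Proof.
move=> e0; have [n [p [h [pP h1 hp]]]] := circle_net e0.
exists n, h, (fun i => mu (p @^-1` [set i])); split=> // [|k j].
  by rewrite -lee_fin fineK ?(variation_index mu pP)// ge0_fin_numE//
    total_mvariation_ge0.
rewrite -rnormN opprB mulrA [e * _]mulrC.
have -> : trig_mx n h (fun i => mu (p @^-1` [set i])) k j =
    simple_integral mu ((fun i => h i ^ (j%:Z - k%:Z)) \o p).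
  by rewrite (simple_integral_index mu_add pP).
apply: vintegral_dist => //.
- by rewrite mulr_ge0 ?ler0n// ltW.
- exact: circle_char_approx.
- exact: borel_simple_comp pP.
- exact: circle_char_dist.
Qed.

Variables (A : op_matrix H).
Hypothesis A_mu : forall k j, A k j = fourier_coef mu (j%:Z - k%:Z).

Lemma schur_fourier_left B C : opmx_bound B C -> opmx_bound (schur A B) (V * C).
Proof.
(* The weight combines the error of the Fourier coefficient with the norm of the entry of [B] that
   multiplies it. *)
move=> BC; apply: (@opmx_bound_approx _ _ _ _
  (fun k j => `|j%:Z - k%:Z|%N%:R * V * rnorm (B k j))) => e e0.
have [n [h [m [h1 mV Am]]]] := fourier_coef_approx e0.
exists (schur (trig_mx n h m) B); split=> [|k j].
  apply: opmx_boundW (trig_schur_left n h1 m BC).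
  by rewrite ler_wpM2r//; case: BC.
rewrite bop_compBl (le_trans (rnorm_comp_le _ _))// mulrA.
by rewrite ler_wpM2r ?rnorm_ge0// A_mu; exact: Am.
Qed.

Lemma schur_fourier_right B C : opmx_bound B C -> opmx_bound (schur B A) (V *
  C).
Proof.
move=> BC; apply: (@opmx_bound_approx _ _ _ _
  (fun k j => rnorm (B k j) * (`|j%:Z - k%:Z|%N%:R * V))) => e e0.
have [n [h [m [h1 mV Am]]]] := fourier_coef_approx e0.
exists (schur B (trig_mx n h m)); split=> [|k j].
  apply: opmx_boundW (trig_schur_right n h1 m BC).
  by rewrite ler_wpM2r//; case: BC.
rewrite bop_compBr (le_trans (rnorm_comp_le _ _))// mulrCA.
by rewrite ler_wpM2l ?rnorm_ge0// A_mu; exact: Am.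
Qed.

End ToeplitzApproximation.

Theorem theorem5p4 (R : realType) (H : completeNormedModType R[i])
    (dot : {dot H for conjC})
    (norm_dot : forall x : H, `|x| ^+ 2 = dot x x)
    (separableH : exists2 D : set H, countable D & dense D)
    (mu : set (circle R) -> bop H H) (mu_bv : bv_measure mu)
    (A : op_matrix H)
    (A_mu : forall k j, A k j = fourier_coef mu (j%:Z - k%:Z)) :
  [/\ left_multiplier A, right_multiplier A &
      (maxe (left_multiplier_norm A) (right_multiplier_norm A)
         <= total_mvariation mu)%E].
Proof.
have [mu_add _ mu_fin] := mu_bv.
have mu0 := total_mvariation_ge0 mu; have V0 := fine_ge0 mu0.
have muE : total_mvariation mu = (fine (total_mvariation mu))%:E.
  by rewrite fineK// ge0_fin_numE.
have [Al Al_le] := left_multiplier_le V0 (schur_fourier_left mu_add mu_fin A_mu).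
have [Ar Ar_le] := right_multiplier_le V0 (schur_fourier_right mu_add mu_fin A_mu).
by split=> //; rewrite muE ge_max Al_le.
Qed.
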